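(* Let $I$ be an instance of Max 2-KP (Max d-KP with $d=2$) on $n$ items that has an equivalent graph. Then $I$ can be solved (an optimal feasible solution can be computed) in time $O(n^3)$.
   Context: Max d-KP: an instance consists of a set $A=\{a_1,\ldots,a_n\}$ of $n$ items and a positive integer $d$ of dimensions. Each item $a_j$ has a non-negative real profit $p_j$ and, for each dimension $i\in\{1,\ldots,d\}$, a non-negative real size $s_{i,j}$. For each dimension $i$ there is a non-negative real capacity $c_i$. A subset $A'\subseteq A$ is a feasible solution if $\sum_{a_j\in A'}s_{i,j}\le c_i$ for all $i$. The task is to find a feasible solution of maximum total profit. An instance $I$ and a finite simple graph $G=(V,E)$ are equivalent if there is a bijection $f:A\to V$ such that $A'\subseteq A$ is feasible for $I$ if and only if $f(A')$ is an independent set of $G$. *)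

(* Defs.v *)
From HB Require Import structures.
From mathcomp Require Import all_boot all_order all_algebra.
From mathcomp Require Import all_classical all_reals all_analysis.
Set Implicit Arguments.
Unset Strict Implicit.
Unset Printing Implicit Defensive.
Import Order.TTheory GRing.Theory Num.Theory.
Import numFieldNormedType.Exports.
Local Open Scope ring_scope.

Record maxKP (R : realType) (d n : nat) := MaxKP {
  kp_profit : 'I_n -> R;
  kp_size : 'I_d -> 'I_n -> R;
  kp_cap : 'I_d -> R;
  kp_dim_gt0 : (0 < d)%N;
  kp_profit_ge0 : forall j, 0 <= kp_profit j;
  kp_size_ge0 : forall i j, 0 <= kp_size i j;
  kp_cap_ge0 : forall i, 0 <= kp_cap i
}.

Definition feasible (R : realType) (d n : nat) (I : maxKP R d n)
    (A : {set 'I_n}) : Prop :=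
  forall i, \sum_(j in A) kp_size I i j <= kp_cap I i.

Definition total_profit (R : realType) (d n : nat) (I : maxKP R d n)
    (A : {set 'I_n}) : R :=
  \sum_(j in A) kp_profit I j.

Definition optimal (R : realType) (d n : nat) (I : maxKP R d n)
    (A : {set 'I_n}) : Prop :=
  feasible I A /\
  forall B, feasible I B -> total_profit I B <= total_profit I A.

Record sgraph := SGraph {
  vertex : finType;
  edge : rel vertex;
  edge_sym : symmetric edge;
  edge_irrefl : irreflexive edge
}.

Definition independent (G : sgraph) (S : {set vertex G}) : Prop :=
  {in S &, forall u v, ~~ edge u v}.

Definition equivalent (R : realType) (d n : nat) (I : maxKP R d n)
    (G : sgraph) : Prop :=
  exists f : 'I_n -> vertex G,
    bijective f /\ forall A, feasible I A <-> independent (f @: A).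

(* Running time is measured on a real RAM with unit cost per executed
   instruction.  It has integer registers x_k and real registers y_k, a random
   access memory for each of the two sorts addressed through integer registers,
   and an output tape of naturals.  Integers admit only addition and truncated
   subtraction, 0 and 1 are the only real constants, and reals cannot be
   converted into integers (in particular there is no floor operation).
   Instruction arguments are register numbers, except for the literal of IConst
   and the jump targets l. *)
Inductive rop := RAdd | RSub | RMul | RDiv.

Inductive instr :=
| IConst (k v : nat)       (* x_k := v *)
| IAdd (k a b : nat)       (* x_k := x_a + x_b *)
| ISub (k a b : nat)       (* x_k := x_a - x_b *)
| ILoad (k a : nat)        (* x_k := imem[x_a] *)
| IStore (a k : nat)       (* imem[x_a] := x_k *)
| RConst (k : nat) (b : bool)             (* y_k := 0 or 1 *)
| ROp (o : rop) (k a b : nat)             (* y_k := y_a o y_b *)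
| RLoad (k a : nat)        (* y_k := rmem[x_a] *)
| RStore (a k : nat)       (* rmem[x_a] := y_k *)
| Jump (l : nat)
| IJumpLe (a b l : nat)    (* if x_a <= x_b goto l *)
| RJumpLe (a b l : nat)    (* if y_a <= y_b goto l *)
| Out (a : nat)            (* append x_a to the output tape *)
| Halt.

Definition program := seq instr.

Record state (R : realType) := State {
  pc : nat;
  ireg : nat -> nat;
  rreg : nat -> R;
  imem : nat -> nat;
  rmem : nat -> R;
  out : seq nat
}.

Definition rop_eval (R : realType) (o : rop) (x y : R) : R :=
  match o with
  | RAdd => x + y
  | RSub => x - y
  | RMul => x * y
  | RDiv => x / y
  end.

(* None means that the machine has halted; leaving the program halts. *)
Definition step (R : realType) (P : program) (s : state R) :
    option (state R) :=
  let: State p x y m M o := s in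
  match nth Halt P p with
  | IConst k v => Some (State p.+1 [eta x with k |-> v] y m M o)
  | IAdd k a b => Some (State p.+1 [eta x with k |-> (x a + x b)%N] y m M o)
  | ISub k a b => Some (State p.+1 [eta x with k |-> (x a - x b)%N] y m M o)
  | ILoad k a => Some (State p.+1 [eta x with k |-> m (x a)] y m M o)
  | IStore a k => Some (State p.+1 x y [eta m with x a |-> x k] M o)
  | RConst k b => Some (State p.+1 x [eta y with k |-> (b : nat)%:R] m M o)
  | ROp f k a b =>
      Some (State p.+1 x [eta y with k |-> rop_eval f (y a) (y b)] m M o)
  | RLoad k a => Some (State p.+1 x [eta y with k |-> M (x a)] m M o)
  | RStore a k => Some (State p.+1 x y m [eta M with x a |-> y k] o)
  | Jump l => Some (State l x y m M o)
  | IJumpLe a b l =>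
      Some (State (if (x a <= x b)%N then l else p.+1) x y m M o)
  | RJumpLe a b l =>
      Some (State (if y a <= y b then l else p.+1) x y m M o)
  | Out a => Some (State p.+1 x y m M (rcons o (x a)))
  | Halt => None
  end.

(* The state after t steps, or the halting state if it is reached earlier. *)
Fixpoint run (R : realType) (P : program) (t : nat) (s : state R) : state R :=
  if t is t'.+1 then
    if step P s is Some s' then run P t' s' else s
  else s.

(* c_1, ..., c_d, then p_j, s_{1,j}, ..., s_{d,j} for each item j in turn. *)
Definition encode (R : realType) (d n : nat) (I : maxKP R d n) : seq R :=
  [seq kp_cap I i | i <- enum 'I_d] ++
  flatten [seq kp_profit I j :: [seq kp_size I i j | i <- enum 'I_d]
          | j <- enum 'I_n].

Definition init (R : realType) (d n : nat) (I : maxKP R d n) : state R :=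
  State 0 [eta (fun=> 0%N) with 0%N |-> n] (fun=> 0) (fun=> 0%N)
        (fun k => nth 0 (encode I) k) [::].

(* The output tape lists the items of the solution, each exactly once. *)
Definition solves_within (R : realType) (d n : nat) (P : program) (t : nat)
    (I : maxKP R d n) : Prop :=
  let s := run P t (init I) in
  step P s = None /\
  exists A : {set 'I_n},
    optimal I A /\ perm_eq (out s) [seq val j | j <- enum A].

(* Main.v *)
(* For items u and v let Q(u,v) be the set of the items w such that, in
   dimension 1, w is not larger than u and either equals u or fits together
   with u, and likewise in dimension 2 with v.  Any two items of Q(u,v) fit
   together: if neither of them is u, then replacing one by u only increases
   the load in dimension 1.  As feasibility is independence in a graph,
   pairwise compatibility is enough, so Q(u,v) is feasible.  Conversely a
   nonempty feasible set is contained in Q(u,v) for u largest in dimension 1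
   and v largest in dimension 2.  Since profits are non-negative, the best of
   the n^2 sets Q(u,v) is optimal, and each is evaluated in time O(n). *)
Require Import Defs.
From mathcomp Require Import all_boot all_order all_algebra.
From mathcomp Require Import all_classical all_reals all_analysis.
From mathcomp Require Import zify.
Set Implicit Arguments.
Unset Strict Implicit.
Unset Printing Implicit Defensive.
Import Order.TTheory GRing.Theory Num.Theory.
Import numFieldNormedType.Exports.
Local Open Scope classical_set_scope.
Local Open Scope ring_scope.

(** * Timed execution *)

(** Quantifying over the remaining time [t] makes composition a plain addition of step counts, and
    [j <= k] lets branches of different lengths share one bound. *)
Definition reaches {R : realType} (P : program) (k : nat) (s s' : state R) :=
  exists2 j, (j <= k)%N & forall t, run P (j + t) s = run P t s'.

Lemma reaches_refl {R : realType} P k (s : state R) : reaches P k s s.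
Proof. by exists 0%N. Qed.

Lemma reaches_trans {R : realType} P k1 k2 (s1 s2 s3 : state R) :
  reaches P k1 s1 s2 -> reaches P k2 s2 s3 -> reaches P (k1 + k2) s1 s3.
Proof.
move=> [j1 le1 r1] [j2 le2 r2]; exists (j1 + j2)%N; first exact: leq_add.
by move=> t; rewrite -addnA r1 r2.
Qed.

Lemma reaches_weaken {R : realType} P k1 k2 (s s' : state R) :
  (k1 <= k2)%N -> reaches P k1 s s' -> reaches P k2 s s'.
Proof. by move=> le12 [j lej r]; exists j => //; apply: leq_trans le12. Qed.

Lemma reaches_step {R : realType} P k (s1 s2 s3 : state R) :
  step P s1 = Some s2 -> reaches P k s2 s3 -> reaches P k.+1 s1 s3.
Proof.
by move=> st [j lej r]; exists j.+1 => // t; rewrite addSn /= st.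
Qed.

Lemma run_halted {R : realType} P t (s : state R) :
  step P s = None -> run P t s = s.
Proof. by case: t => //= t ->. Qed.

(** A halted state is fixed by [run], so the steps left over in the budget change nothing. *)
Lemma reaches_halted {R : realType} P k (s s' : state R) :
  reaches P k s s' -> step P s' = None -> run P k s = s'.
Proof. by move=> [j lej r] halt; rewrite -(subnKC lej) r run_halted. Qed.

(** With the offset written [i + b], a literal [i] reduces to successors of [b], the form in which
    [step] produces program counters. *)
Definition code_at (P : program) (b : nat) (c : seq instr) :=
  forall i, (i < size c)%N -> nth Halt P (i + b) = nth Halt c i.

Ltac exec_instr H := apply: reaches_step; first by rewrite /step H.

(** * Membership test *)

(* Item [j] occupies the cells [3 j + 2], [3 j + 3] and [3 j + 4]. *)
Definition cell (j a : nat) := (j + j + j + a)%N.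

Definition fits {R : realType} (M : nat -> R) (a : nat) (c : R) (u w : nat) :=
  (M (cell w a) <= M (cell u a)) &&
  ((w == u) || (M (cell u a) + M (cell w a) <= c)).

(* Falls through if [fits] holds and jumps to [fail] otherwise; [b] is the
   address of the first instruction. *)
Definition fits_code (u w a c b fail : nat) : seq instr :=
  [:: IAdd 9 u u; IAdd 9 9 u; IAdd 9 9 a; RLoad 4 9;
      IAdd 10 w w; IAdd 10 10 w; IAdd 10 10 a; RLoad 5 10;
      RJumpLe 5 4 (10 + b); Jump fail;
      IJumpLe w u (12 + b); Jump (13 + b); IJumpLe u w (16 + b);
      ROp RAdd 4 4 5; RJumpLe 4 c (16 + b); Jump fail].

(** The block writes only to integer registers 9, 10 and real registers 4, 5, which the bounds on
    [u], [w], [a], [c] avoid. All its internal jumps go forward, so its 16 instructions bound the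
    time. *)
Lemma fits_codeP {R : realType} P b u w a c fail x (y : nat -> R) m M o :
  code_at P b (fits_code u w a c b fail) ->
  (u < 9)%N -> (w < 9)%N -> (a < 9)%N -> (c < 4)%N ->
  exists x' y',
    [/\ forall i, (i < 9)%N -> x' i = x i, forall i, (i < 4)%N -> y' i = y i &
    reaches P 16 (State b x y m M o)
      (State (if fits M (x a) (y c) (x u) (x w) then (16 + b)%N else fail)
         x' y' m M o)].
Proof.
move=> code u9 w9 a9 c4.
have ne9 i : (i < 9)%N -> (i == 9%N) = false by lia.
have ne10 i : (i < 9)%N -> (i == 10%N) = false by lia.
have xe k v (z : nat -> nat) i : (i < 9)%N -> (9 <= k)%N ->
    [eta z with k |-> v] i = z i by move=> ? ? /=; case: eqP => //; lia.
have ye k v (z : nat -> R) i : (i < 4)%N -> (4 <= k)%N ->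
    [eta z with k |-> v] i = z i by move=> ? ? /=; case: eqP => //; lia.
have [x1 [y1 [ex ey y14 y15 r8]]] : exists x1 y1,
  [/\ forall i, (i < 9)%N -> x1 i = x i, forall i, (i < 4)%N -> y1 i = y i,
      y1 4%N = M (cell (x u) (x a)), y1 5%N = M (cell (x w) (x a)) &
      reaches P 8 (State b x y m M o) (State (8 + b) x1 y1 m M o)].
  (* Executing the code first instantiates the final registers; their properties are then read
     off. *)
  eexists; eexists; split; last first.
  - exec_instr (code 0%N isT); exec_instr (code 1%N isT).
    exec_instr (code 2%N isT); exec_instr (code 3%N isT).
    exec_instr (code 4%N isT); exec_instr (code 5%N isT).
    exec_instr (code 6%N isT); exec_instr (code 7%N isT).
    exact: reaches_refl.
  - by rewrite /= !ne9 ?ne10.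
  - by rewrite /= !ne9 ?ne10.
  - by move=> i i4; rewrite !ye.
  - by move=> i i9; rewrite !xe.
rewrite /fits -y14 -y15 -(ex u) // -(ex w) // -(ey c) //.
case sle: (y1 5%N <= y1 4%N) => /=; last first.
  exists x1, y1; split=> //; apply: (reaches_trans (k2 := 8) r8).
  exec_instr (code 8%N isT); rewrite /= sle.
  exec_instr (code 9%N isT); exact: reaches_refl.
have r9 : reaches P 9 (State b x y m M o) (State (10 + b) x1 y1 m M o).
  apply: (reaches_trans (k2 := 1) r8).
  exec_instr (code 8%N isT); rewrite /= sle; exact: reaches_refl.
have [weu | wneu] /= := eqVneq (x1 w) (x1 u).
  exists x1, y1; split=> //; apply: (reaches_trans (k2 := 7) r9).
  exec_instr (code 10%N isT); rewrite /= weu leqnn.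
  exec_instr (code 12%N isT); rewrite /= weu leqnn; exact: reaches_refl.
(* Equality of item numbers is tested by two comparisons; for distinct items one of them fails, and
   both outcomes lead to the load test. *)
have r12 : reaches P 11 (State b x y m M o) (State (13 + b) x1 y1 m M o).
  apply: (reaches_trans (k2 := 2) r9).
  exec_instr (code 10%N isT) => /=; case: leqP => leuw.
    exec_instr (code 12%N isT) => /=; rewrite leqNgt ltn_neqAle wneu leuw /=.
    exact: reaches_refl.
  exec_instr (code 11%N isT); exact: reaches_refl.
exists x1, [eta y1 with 4%N |-> y1 4%N + y1 5%N]; split=> //.
  by move=> i i4; rewrite ye // ey.
apply: (reaches_trans (k2 := 5) r12).
exec_instr (code 13%N isT); exec_instr (code 14%N isT) => /=.
have -> : (c == 4%N) = false by lia.
case: ifP => _; first exact: reaches_refl.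
exec_instr (code 15%N isT); exact: reaches_refl.
Qed.

Definition member {R : realType} (M : nat -> R) (u v w : nat) :=
  fits M 3 (M 0%N) u w && fits M 4 (M 1%N) v w.

Definition member_code (u v b fail : nat) : seq instr :=
  fits_code u 3 7 0 b fail ++ fits_code v 3 8 1 (16 + b) fail.

Definition consts {R : realType} (M : nat -> R) (n : nat) (x : nat -> nat)
    (y : nat -> R) :=
  [/\ x 0%N = n, x 6%N = 1%N, x 7%N = 3%N, x 8%N = 4%N &
      y 0%N = M 0%N /\ y 1%N = M 1%N].

Lemma member_codeP {R : realType} P b u v fail n x (y : nat -> R) m M o :
  code_at P b (member_code u v b fail) ->
  (u < 9)%N -> (v < 9)%N -> consts M n x y ->
  exists x' y',
    [/\ forall i, (i < 9)%N -> x' i = x i, forall i, (i < 4)%N -> y' i = y i &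
    reaches P 32 (State b x y m M o)
      (State (if member M (x u) (x v) (x 3%N) then (32 + b)%N else fail)
         x' y' m M o)].
Proof.
move=> code u9 v9 [_ _ x7 x8 [y0 y1]].
have code1 : code_at P b (fits_code u 3 7 0 b fail).
  move=> i i16; rewrite code; last by rewrite size_cat ltn_addr.
  by rewrite nth_cat i16.
have code2 : code_at P (16 + b) (fits_code v 3 8 1 (16 + b) fail).
  move=> i i16; rewrite addnCA addnA code; last by rewrite size_cat ltn_add2l.
  by rewrite nth_cat ltnNge leq_addr addKn.
have [//|//|//|//|x1 [y1_ [ex1 ey1 r1]]] :=
  fits_codeP x y m M o code1.
rewrite /member; rewrite x7 y0 in r1.
case: ifP r1 => _ r1 /=; last first.
  by exists x1, y1_; split=> //; apply: reaches_weaken r1.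
have [//|//|//|//|x2 [y2 [ex2 ey2 r2]]] :=
  fits_codeP x1 y1_ m M o code2.
exists x2, y2; split=> [i i9|i i4|]; rewrite ?ex2 ?ey2 ?ex1 ?ey1 //.
by have := reaches_trans (k2 := 16) r1 r2; rewrite !ex1 // !ey1 // x8 y1.
Qed.

(** * The program *)

(* Integer registers: 0 holds n, 1 to 3 the loop variables u, v, w, 4 and 5 the
   best pair (u, v) so far, 6 to 8 the constants of [consts]; real registers: 0
   and 1 hold the capacities, 2 the best profit so far, 3 the profit of the
   current candidate.  All others are temporary.  Jump targets are labelled by
   their addresses. *)
Definition knapsack : program :=
  [:: IConst 6 1; IConst 7 3; IConst 8 4; RLoad 0 1; RLoad 1 6;
  (* 5 *) IJumpLe 0 1 61; IConst 2 0;
  (* 7 *) IJumpLe 0 2 59; IConst 3 0; RConst 3 false;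
  (* 10 *) IJumpLe 0 3 51]
  ++ member_code 1 2 11 49 ++
  [:: IConst 10 2; IAdd 9 3 3; IAdd 9 9 3; IAdd 9 9 10; RLoad 4 9;
      ROp RAdd 3 3 4;
  (* 49 *) IAdd 3 3 6; Jump 10;
  (* 51 *) RJumpLe 3 2 57; IConst 10 0; IAdd 4 1 10; IAdd 5 2 10; RConst 4 false;
      ROp RAdd 2 3 4;
  (* 57 *) IAdd 2 2 6; Jump 7;
  (* 59 *) IAdd 1 1 6; Jump 5;
  (* 61 *) IConst 3 0;
  (* 62 *) IJumpLe 0 3 98]
  ++ member_code 4 5 63 96 ++
  [:: Out 3;
  (* 96 *) IAdd 3 3 6; Jump 62].

Lemma member_code_at11 : code_at knapsack 11 (member_code 1 2 11 49).
Proof. by do 32?[case=> //]. Qed.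

Lemma member_code_at63 : code_at knapsack 63 (member_code 4 5 63 96).
Proof. by do 32?[case=> //]. Qed.

Ltac exec := apply: reaches_step; first by rewrite /=.

Lemma consts_eq {R : realType} (M : nat -> R) n x y x' y' :
  consts M n x y -> (forall i, i \in [:: 0; 6; 7; 8]%N -> x' i = x i) ->
  (forall i, (i < 2)%N -> y' i = y i) -> consts M n x' y'.
Proof. by move=> [? ? ? ? [? ?]] ex ey; split; [..|split]; rewrite ?ex ?ey. Qed.

(** * Loop invariants and step counts *)

Definition value {R : realType} (M : nat -> R) (n u v : nat) : R :=
  \sum_(0 <= w < n | member M u v w) M (cell w 2).

(** Induction on the number [r] of items left. A round costs 1 for the loop test, 32 for membership,
    at most 6 for adding the profit and 2 for the increment and jump; the final test costs 1. *)
Lemma w_loopP {R : realType} m (M : nat -> R) o n r x y :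
  consts M n x y -> (x 3 + r)%N = n ->
  exists x' y', [/\ forall i, (i < 9)%N -> i != 3%N -> x' i = x i,
    forall i, (i < 3)%N -> y' i = y i,
    y' 3%N = y 3%N +
      \sum_(x 3%N <= w < n | member M (x 1%N) (x 2%N) w) M (cell w 2) &
    reaches knapsack (41 * r + 1) (State 10 x y m M o) (State 51 x' y' m M o)].
Proof.
elim: r x y => [|r IHr] x y cst xr.
  exists x, y; split=> //; first by rewrite big_geq ?addr0 // -xr addn0.
  by exec; case: (cst) => -> *; rewrite -xr addn0 leqnn; apply: reaches_refl.
have [x0 x6 _ _ _] := cst.
have [x1 [y1 [ex1 ey1 r1]]] :=
  member_codeP m o member_code_at11 isT isT cst.
have r1' : reaches knapsack 33 (State 10 x y m M o)
    (State (if member M (x 1%N) (x 2%N) (x 3%N) then 43%N else 49%N) x1 y1 m M o).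
  by exec; rewrite x0 ifF //; lia.
have [x2 [y2 [ex2 ey2 y23 r2]]] : exists x2 y2,
  [/\ forall i, (i < 9)%N -> x2 i = x i, forall i, (i < 3)%N -> y2 i = y i,
    y2 3%N = y 3%N +
      (if member M (x 1%N) (x 2%N) (x 3%N) then M (cell (x 3%N) 2) else 0) &
    reaches knapsack 39 (State 10 x y m M o) (State 49 x2 y2 m M o)].
  case: ifP r1' => _ r1'; last first.
    exists x1, y1; split=> //; last exact: reaches_weaken r1'.
    - by move=> i i3; apply: ey1; lia.
    - by rewrite ey1 // addr0.
  eexists; eexists; split; last first.
  - apply: (reaches_trans (k2 := 6) r1').
    by exec; exec; exec; exec; exec; exec; apply: reaches_refl.
  - by rewrite /= !ex1 // ey1.
  - by move=> [|[|[]]] //= _; rewrite ey1.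
  - move=> i i9 /=; rewrite !ifN ?ex1 //; lia.
have [| |x3 [y3 [ex3 ey3 y33 r3]]] := IHr [eta x2 with 3%N |-> (x 3%N).+1] y2.
- apply: (consts_eq cst) => i.
    by rewrite !inE => /or4P[]/eqP-> /=; rewrite ex2.
  by move=> i2; rewrite ey2 //; lia.
- by rewrite /= addSnnS.
exists x3, y3; split=> [i i9 i3|i i3||].
- by rewrite ex3 //= (negPf i3) ex2.
- by rewrite ey3 ?ey2.
- rewrite y33 y23 /= !ex2 // -addrA; congr (_ + _).
  rewrite [in RHS]big_ltn_cond; last by lia.
  by case: ifP => _; rewrite ?add0r.
- apply: (reaches_weaken (k1 := 39 + (2 + (41 * r + 1)))); first by lia.
  apply: (reaches_trans r2); exec; exec.
  rewrite !ex2 // x6 (addn1 (x _)); exact: r3.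
Qed.

(** The best profit so far is only bounded by the value of the stored pair: it starts at 0, while
    the initial pair (0,0) may already have positive value. A round adds at most 11 steps to the
    [41 * n + 1] of the inner loop. *)
Lemma v_loopP {R : realType} m (M : nat -> R) o n r x y :
  consts M n x y -> (x 2 + r)%N = n -> y 2%N <= value M n (x 4%N) (x 5%N) ->
  exists x' y', [/\ consts M n x' y' /\ x' 1%N = x 1%N,
    y 2%N <= y' 2%N <= value M n (x' 4%N) (x' 5%N),
    forall v, (x 2 <= v < n)%N -> value M n (x 1%N) v <= y' 2%N &
    reaches knapsack (r * (41 * n + 12) + 1)
      (State 7 x y m M o) (State 59 x' y' m M o)].
Proof.
elim: r x y => [|r IHr] x y cst xr yle.
  exists x, y; split=> //; first by rewrite lexx.
    by move=> v; lia.
  by exec; case: (cst) => -> *; rewrite -xr addn0 leqnn; apply: reaches_refl.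
have [x0 x6 _ _ _] := cst.
have [||x1 [y1 [ex1 ey1 y13 r1]]] := @w_loopP R m M o n n
    [eta x with 3%N |-> 0%N] [eta y with 3%N |-> 0].
- apply: (consts_eq cst) => [i|[|[]]] //.
  by rewrite !inE => /or4P[]/eqP->.
- by rewrite /= add0n.
rewrite /= add0r -/(value M n _ _) in y13.
have r1' : reaches knapsack (3 + (41 * n + 1)) (State 7 x y m M o)
    (State 51 x1 y1 m M o).
  by exec; rewrite x0 ifF; [exec; exec|lia].
have [x2 [y2 [ex2 ey2 y2b y2v r2]]] : exists x2 y2,
  [/\ forall i, (i < 9)%N -> i \notin [:: 3; 4; 5]%N -> x2 i = x i,
    forall i, (i < 2)%N -> y2 i = y i,
    y 2%N <= y2 2%N <= value M n (x2 4%N) (x2 5%N),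
    value M n (x 1%N) (x 2%N) <= y2 2%N &
    reaches knapsack (41 * n + 10) (State 7 x y m M o) (State 57 x2 y2 m M o)].
  have [sle|slt] := leP (y1 3%N) (y1 2%N).
    exists x1, y1; split.
    - by move=> i i9; rewrite !inE !negb_or => /and3P[i3 _ _]; rewrite ex1 //= (negPf i3).
    - by move=> [|[]] // _; rewrite ey1.
    - by rewrite !ex1 // !ey1 //= lexx.
    - by rewrite -y13.
    - apply: (reaches_weaken (k1 := 3 + (41 * n + 1) + 1)); first by lia.
      by apply: (reaches_trans r1'); exec; rewrite sle; apply: reaches_refl.
  (* A strict improvement: the pair and the profit are copied by adding 0. *)
  eexists; eexists; split; last first.
  - apply: (reaches_weaken (k1 := 3 + (41 * n + 1) + 6)); first by lia.
    apply: (reaches_trans r1'); exec; rewrite leNgt slt /=.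
    by exec; exec; exec; exec; exec; apply: reaches_refl.
  - by rewrite /= addr0 y13.
  - rewrite /= addr0 !addn0 !ex1 //= y13 lexx andbT -y13.
    by move: slt; rewrite ey1 //= => /ltW.
  - by move=> [|[]] //= _; rewrite ey1.
  - move=> i i9; rewrite !inE !negb_or => /and3P[i3 i4 i5] /=.
    by rewrite (negPf i4) (negPf i5) ifN ?ex1 //= ?(negPf i3) //; lia.
have /andP[yy2 y2val] := y2b.
have [|||x3 [y3 [[cst3 x31] /andP[y23 y3b] y3v r3]]] :=
  IHr [eta x2 with 2%N |-> (x 2%N).+1] y2.
- apply: (consts_eq cst) => i.
    by rewrite !inE => /or4P[]/eqP-> /=; rewrite ex2.
  by move=> i2; rewrite ey2.
- by rewrite /= addSnnS.
- by [].
rewrite /= in x31 y3v; exists x3, y3; split.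
- by rewrite x31 ex2.
- by rewrite (le_trans yy2).
- move=> v /andP[]; rewrite leq_eqVlt => /predU1P[<- _|lt ltn].
    exact: le_trans y2v y23.
  by rewrite -(ex2 1%N) // y3v // lt.
- apply: (reaches_weaken (k1 := 41 * n + 10 + (2 + (r * (41 * n + 12) + 1)))); first by lia.
  apply: (reaches_trans r2); exec; exec.
  rewrite !ex2 // x6 (addn1 (x _)); exact: r3.
Qed.

Lemma u_loopP {R : realType} m (M : nat -> R) o n r x y :
  consts M n x y -> (x 1 + r)%N = n -> y 2%N <= value M n (x 4%N) (x 5%N) ->
  exists x' y', [/\ consts M n x' y',
    y 2%N <= y' 2%N <= value M n (x' 4%N) (x' 5%N),
    forall u v, (x 1 <= u < n)%N -> (v < n)%N -> value M n u v <= y' 2%N &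
    reaches knapsack (r * (n * (41 * n + 12) + 5) + 1)
      (State 5 x y m M o) (State 61 x' y' m M o)].
Proof.
elim: r x y => [|r IHr] x y cst xr yle.
  exists x, y; split=> //; first by rewrite lexx.
    by move=> u v; lia.
  by exec; case: (cst) => -> *; rewrite -xr addn0 leqnn; apply: reaches_refl.
have [x0 x6 _ _ _] := cst.
have [|||x1 [y1 [[cst1 x11] /andP[yy1 y1b] y1v r1]]] :=
    @v_loopP R m M o n n [eta x with 2%N |-> 0%N] y.
- apply: (consts_eq cst) => // i.
  by rewrite !inE => /or4P[]/eqP->.
- by rewrite /= add0n.
- by [].
have [_ x16 _ _ _] := cst1.
rewrite /= in x11 y1v.
have [|||x2 [y2 [cst2 /andP[y12 y2b] y2v r2]]] :=
  IHr [eta x1 with 1%N |-> (x 1%N).+1] y1.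
- apply: (consts_eq cst1) => // i.
  by rewrite !inE => /or4P[]/eqP->.
- by rewrite /= addSnnS.
- by [].
exists x2, y2; split=> //.
- by rewrite (le_trans yy1).
- move=> u v /andP[]; rewrite leq_eqVlt => /predU1P[<- _ vn|lt ltn vn].
    by apply: le_trans y12; apply: y1v.
  by apply: y2v => //; rewrite /= lt.
- apply: (reaches_weaken (k1 :=
    2 + ((n * (41 * n + 12) + 1) + (2 + (r * (n * (41 * n + 12) + 5) + 1))))).
    by lia.
  exec; rewrite x0 ifF; last by lia.
  exec; apply: (reaches_trans r1); exec; exec.
  rewrite x11 x16 (addn1 (x _)); exact: r2.
Qed.

(** Only the best pair is stored, so membership is tested again for each item: 1 + 32 + 1 + 2 steps
    per round. *)
Lemma out_loopP {R : realType} m (M : nat -> R) o n r x y :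
  consts M n x y -> (x 3 + r)%N = n ->
  exists x' y', reaches knapsack (36 * r + 1) (State 62 x y m M o)
    (State 98 x' y' m M
      (o ++ [seq w <- iota (x 3%N) r | member M (x 4%N) (x 5%N) w])).
Proof.
elim: r o x y => [|r IHr] o x y cst xr.
  exists x, y; rewrite cats0.
  by exec; case: (cst) => -> *; rewrite -xr addn0 leqnn; apply: reaches_refl.
have [x0 x6 _ _ _] := cst.
have [x1 [y1 [ex1 ey1 r1]]] :=
  member_codeP m o member_code_at63 isT isT cst.
have r1' : reaches knapsack 34 (State 62 x y m M o)
    (State 96 x1 y1 m M (if member M (x 4%N) (x 5%N) (x 3%N)
                         then rcons o (x 3%N) else o)).
  exec; rewrite x0 ifF; last by lia.
  rewrite -(addn1 32); apply: (reaches_trans r1); case: ifP => _.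
    by exec; rewrite ex1 //; apply: reaches_refl.
  exact: reaches_refl.
set o1 := (if _ then _ else _) in r1'.
have [||x2 [y2 r2]] := IHr o1 [eta x1 with 3%N |-> (x 3%N).+1] y1.
- apply: (consts_eq cst) => i.
    by rewrite !inE => /or4P[]/eqP-> /=; rewrite ex1.
  by move=> i2; rewrite ey1 //; lia.
- by rewrite /= addSnnS.
exists x2, y2.
apply: (reaches_weaken (k1 := 34 + (2 + (36 * r + 1)))); first by lia.
apply: (reaches_trans r1'); exec; exec.
rewrite !ex1 // x6 (addn1 (x _)); move: r2; rewrite /= !ex1 // /o1.
by case: ifP => _; rewrite ?cat_rcons.
Qed.

Lemma knapsackP {R : realType} n m (M : nat -> R) :
  (forall u v, 0 <= value M n u v) ->
  exists bu bv x y,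
    (forall u v, (u < n)%N -> (v < n)%N -> value M n u v <= value M n bu bv) /\
    run knapsack (100 * n ^ 3 + 8)
      (State 0 [eta (fun=> 0%N) with 0%N |-> n] (fun=> 0) m M [::]) =
    State 98 x y m M [seq w <- iota 0 n | member M bu bv w].
Proof.
move=> v0; set s0 := State _ _ _ _ _ _.
(* Register 1 is still 0 and register 6 already 1 when the loads use them as addresses, so they
   fetch the two capacities. *)
have [x1 [y1 [[cst1 x11 y12] r1]]] : exists x1 y1,
    [/\ consts M n x1 y1, x1 1%N = 0%N & y1 2%N = 0] /\
    reaches knapsack 5 s0 (State 5 x1 y1 m M [::]).
  eexists; eexists; split; last first.
    by exec; exec; exec; exec; exec; apply: reaches_refl.
  by [].
have [||x2 [y2 [cst2 /andP[_ y2b] y2v r2]]] := @u_loopP R m M [::] n n x1 y1 cst1.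
- by rewrite x11.
- by rewrite y12.
have [||x3 [y3 r3]] := @out_loopP R m M [::] n n [eta x2 with 3%N |-> 0%N] y2.
- apply: (consts_eq cst2) => // i.
  by rewrite !inE => /or4P[]/eqP->.
- by rewrite /= add0n.
exists (x2 4%N), (x2 5%N), x3, y3; split.
  move=> u v un vn; apply: le_trans y2b; apply: y2v => //.
  by rewrite x11.
apply: reaches_halted => //.
(* The sum is [41 n^3 + 12 n^2 + 41 n + 8], and [n] and [n^2] are at most [n^3]. *)
apply: (reaches_weaken (k1 :=
  5 + ((n * (n * (41 * n + 12) + 5) + 1) + (1 + (36 * n + 1))))).
  by nia.
apply: (reaches_trans r1); apply: (reaches_trans r2); exec; exact: r3.
Qed.

(** * Correctness *)

Lemma nth_flatten3 (T S : Type) (x0 : S) (y0 : T) (f g h : T -> S) s i a :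
  (i < size s)%N -> (a < 3)%N ->
  nth x0 (flatten [seq [:: f j; g j; h j] | j <- s]) (cell i a) =
  nth x0 [:: f (nth y0 s i); g (nth y0 s i); h (nth y0 s i)] a.
Proof.
elim: s i => [|j s IHs] [|i] // lti a3; first by move: a3; case: (a) => [|[|[]]].
have -> : cell i.+1 a = (cell i a).+3 by rewrite /cell; lia.
exact: IHs.
Qed.

Definition input {R : realType} {n} (I : maxKP R 2 n) (k : nat) : R :=
  nth 0 (encode I) k.

Lemma enum_ord2 : enum 'I_2 = [:: ord0; lift ord0 ord0].
Proof. by rewrite enum_ordSl enum_ordSl /= (size0nil (size_enum_ord 0)). Qed.

Lemma input_cap {R : realType} {n} (I : maxKP R 2 n) (i : 'I_2) :
  input I i = kp_cap I i.
Proof.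
rewrite /input /encode enum_ord2 /=.
by case: i => [[|[|//]] ?] /=; congr kp_cap; apply: val_inj.
Qed.

(** The offset 2 skips the two capacities; blocks of three follow. *)
Lemma input_item {R : realType} {n} (I : maxKP R 2 n) (j : 'I_n) a :
  (a < 3)%N -> input I (cell j (2 + a)) =
  nth 0 [:: kp_profit I j; kp_size I ord0 j; kp_size I (lift ord0 ord0) j] a.
Proof.
move=> a3; rewrite /input /encode enum_ord2 /cell addnCA /=.
rewrite -/(cell j a) (nth_flatten3 _ j) ?size_enum_ord //.
by rewrite nth_ord_enum.
Qed.

Lemma input_profit {R : realType} {n} (I : maxKP R 2 n) (j : 'I_n) :
  input I (cell j 2) = kp_profit I j.
Proof. exact: input_item j 0%N isT. Qed.

Lemma input_size {R : realType} {n} (I : maxKP R 2 n) (i : 'I_2) (j : 'I_n) :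
  input I (cell j (i + 3)) = kp_size I i j.
Proof.
have -> : (i + 3 = 2 + i.+1)%N by lia.
rewrite input_item; last by rewrite ltnS.
by case: i => [[|[|//]] ?] /=; congr kp_size; apply: val_inj.
Qed.

Definition candidate {R : realType} {n} (I : maxKP R 2 n) (u v : nat) :
    {set 'I_n} := [set w : 'I_n | member (input I) u v w].

Lemma value_input {R : realType} {n} (I : maxKP R 2 n) u v :
  value (input I) n u v = total_profit I (candidate I u v).
Proof.
rewrite /value big_mkord; apply: eq_big => [w|w _]; first by rewrite inE.
exact: input_profit.
Qed.

Lemma total_profit_ge0 {R : realType} {d n} (I : maxKP R d n) A :
  0 <= total_profit I A.
Proof. by apply: sumr_ge0 => j _; apply: kp_profit_ge0. Qed.

Lemma total_profit_subset {R : realType} {d n} (I : maxKP R d n)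
    (A B : {set 'I_n}) : A \subset B -> total_profit I A <= total_profit I B.
Proof.
move=> AB; rewrite /total_profit [leRHS](big_setID A) /= (finset.setIidPr AB) lerDl.
exact: total_profit_ge0.
Qed.

(** * Pairwise compatibility and candidate sets *)

Lemma fits_pair {R : realType} (M : nat -> R) a c u w w' :
  w != w' -> fits M a c u w -> fits M a c u w' ->
  M (cell w a) + M (cell w' a) <= c.
Proof.
move=> ww' /andP[lew fw] /andP[lew' fw'].
have [wu|wu] := eqVneq w u.
  by move: ww' fw'; rewrite wu eq_sym => /negPf ->.
rewrite (negPf wu) /= in fw; apply: le_trans fw.
by rewrite addrC lerD2r.
Qed.

Lemma feasible_pair {R : realType} {d n} (I : maxKP R d n) (A : {set 'I_n}) i
    (u w : 'I_n) : feasible I A -> u \in A -> w \in A -> w != u ->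
  kp_size I i u + kp_size I i w <= kp_cap I i.
Proof.
move=> /(_ i) fA uA wA wu; apply: le_trans fA.
rewrite (bigD1 u) //= (bigD1 w) /=; last by rewrite wA.
by rewrite addrA lerDl; apply: sumr_ge0 => j _; apply: kp_size_ge0.
Qed.

(** Independence is a condition on pairs of vertices: each two-element set is feasible by
    assumption, so its image has no edge. *)
Lemma feasible_pairwise {R : realType} {d n} (I : maxKP R d n) G
    (A : {set 'I_n}) : equivalent I G ->
  (forall i, {in A &, forall w w', w != w' ->
    kp_size I i w + kp_size I i w' <= kp_cap I i}) ->
  feasible I A.
Proof.
move=> [f [bijf eqf]] pairs.
apply/eqf => _ _ /imsetP[w wA ->] /imsetP[w' w'A ->].
have [->|ww'] := eqVneq w w'; first by rewrite edge_irrefl.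
have /eqf : feasible I [set w; w'].
  by move=> i; rewrite big_setU1 ?inE // big_set1; apply: pairs.
by apply; apply: imset_f; rewrite !inE eqxx ?orbT.
Qed.

(** Here [u] and [v] are arbitrary naturals, so the lemma applies directly to the pair left in the
    registers. *)
Lemma candidate_feasible {R : realType} {n} (I : maxKP R 2 n) G u v :
  equivalent I G -> feasible I (candidate I u v).
Proof.
move=> eqIG; apply: (feasible_pairwise eqIG) => i w w'.
rewrite !inE => /andP[w0 w1] /andP[w'0 w'1] ww'.
rewrite -!input_size -input_cap.
by case: i => [[|[|//]] ?] /=; [apply: fits_pair w0 w'0|apply: fits_pair w1 w'1].
Qed.

Lemma subset_candidate {R : realType} {n} (I : maxKP R 2 n) (A : {set 'I_n}) a0 :
  feasible I A -> a0 \in A -> exists u v : 'I_n, A \subset candidate I u v.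
Proof.
move=> fA a0A.
have big (i : 'I_2) : exists u : 'I_n, forall w : 'I_n, w \in A ->
    fits (input I) (i + 3) (input I i) u w.
  (* The witness is an item of [A] of largest size in dimension [i]; [a0] ensures that one
     exists. *)
  case: (arg_maxP (kp_size I i) a0A) => u uA umax; exists u => w wA.
  rewrite /fits !input_size input_cap [_ <= _]umax //=.
  have [//|wu] := eqVneq (w : nat) u.
  by rewrite (feasible_pair _ fA).
have [u uP] := big ord0; have [v vP] := big (lift ord0 ord0).
exists u, v; apply/fintype.subsetP => w wA; rewrite inE.
by apply/andP; split; [apply: uP|apply: vP].
Qed.

Theorem theorem4p30 (R : realType) :
  exists (P : program) (T : nat -> nat),
    (fun n : nat => (T n)%:R : R) =O_\oo (fun n : nat => n%:R ^+ 3 : R) /\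
    forall (n : nat) (I : maxKP R 2 n),
      (exists G : sgraph, equivalent I G) -> solves_within P (T n) I.
Proof.
exists knapsack, (fun n => 100 * n ^ 3 + 8)%N; split.
  (* 108 = 100 + 8, as [1 <= n ^ 3] from [n = 1] on. *)
  apply/eqO_exP; exists 108%:R; first by rewrite ltr0n.
  exists 1%N => // n /= n1; rewrite -natrX !ger0_norm // -natrM ler_nat.
  by have : (0 < n ^ 3)%N; [rewrite expn_gt0 n1 | lia].
move=> n I [G eqIG].
have [|bu [bv [x [y [best runE]]]]] := @knapsackP R n (fun=> 0%N) (input I).
  by move=> u v; rewrite value_input total_profit_ge0.
rewrite /solves_within /init runE; split=> //.
exists (candidate I bu bv); split.
  split=> [|B fB]; first exact: candidate_feasible eqIG.
  (* The empty set has no largest item; its profit 0 is bounded by non-negativity. *)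
  have [->|[b bB]] := set_0Vmem B.
    by rewrite {1}/total_profit big_set0 total_profit_ge0.
  have [u [v sub]] := subset_candidate fB bB.
  by apply: le_trans (total_profit_subset I sub) _; rewrite -!value_input best.
(* The tape and [enum] both list the items in increasing order, so the two lists coincide. *)
rewrite /= -val_enum_ord filter_map.
have -> : enum (candidate I bu bv) =
    [seq w <- enum 'I_n | member (input I) bu bv (val w)].
  by rewrite enumT; apply: eq_filter => w; rewrite !inE.
exact: perm_refl.
Qed.
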